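(* Let $X$ and $Y$ be metric spaces, let $F:X\rightrightarrows Y$ be a set-valued mapping and let $(\bar x,\bar y)\in\mathrm{graph}\,F$. Then $F$ is strongly metrically subregular at $(\bar x,\bar y)$ if and only if $$|F|^{\downarrow}(\bar x,\bar y)>0.$$ Moreover, whenever this inequality holds, one has $$\mathrm{subreg}\,F(\bar x,\bar y)=\frac{1}{|F|^{\downarrow}(\bar x,\bar y)},$$ with the convention that $1/(+\infty)=0$.
   Context: In a metric space, $B(x,r)$ denotes the closed ball with center $x$ and radius $r$, and $\mathrm{dist}(x,S)=\inf_{s\in S}d(x,s)$, with $\mathrm{dist}(x,\varnothing)=+\infty$. For a set-valued mapping $F:X\rightrightarrows Y$ between metric spaces, $\mathrm{graph}\,F=\{(x,y): y\in F(x)\}$ and $F^{-1}(y)=\{x\in X: y\in F(x)\}$. $F$ is metrically subregular at $(\bar x,\bar y)\in\mathrm{graph}\,F$ if there exist $\kappa\ge 0$ and $r>0$ such that $$\mathrm{dist}(x,F^{-1}(\bar y))\le\kappa\,\mathrm{dist}(\bar y,F(x)),\quad\forall x\in B(\bar x,r).$$ The modulus of subregularity $\mathrm{subreg}\,F(\bar x,\bar y)$ is the infimum of all $\kappa\ge 0$ for which there exists $r>0$ such that this inequality holds. $F$ is strongly metrically subregular at $(\bar x,\bar y)$ if it is metrically subregular at $(\bar x,\bar y)$ and, in addition, $\bar x$ is an isolated point of $F^{-1}(\bar y)$; equivalently, if there exist $\kappa\ge0$ and $r>0$ such that $d(x,\bar x)\le\kappa\,\mathrm{dist}(\bar y,F(x))$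 for all $x\in B(\bar x,r)$. The steepest displacement rate of $F$ at $(\bar x,\bar y)\in\mathrm{graph}\,F$ is the (nonnegative, possibly infinite) quantity $$|F|^{\downarrow}(\bar x,\bar y)=\liminf_{x\to\bar x}\frac{\mathrm{dist}(\bar y,F(x))-\mathrm{dist}(\bar y,F(\bar x))}{d(x,\bar x)}=\liminf_{x\to\bar x}\frac{\mathrm{dist}(\bar y,F(x))}{d(x,\bar x)},$$ where the lower limit is taken over $x\ne\bar x$. *)

(* Defs.v *)
From HB Require Import structures.
From mathcomp Require Import all_boot all_order all_algebra.
From mathcomp Require Import all_classical all_reals all_analysis.

Set Implicit Arguments.
Unset Strict Implicit.
Unset Printing Implicit Defensive.

Import Order.TTheory GRing.Theory Num.Theory.
Import numFieldNormedType.Exports.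

Local Open Scope classical_set_scope.
Local Open Scope ring_scope.

(* The library's [closed_ball] is the closure of the open ball, which may be
   smaller than this one in a general metric space. *)
Definition cball (R : realType) (X : metricType R) (x : X) (r : R) : set X :=
  [set z | mdist x z <= r].

(* [ereal_inf set0 = +oo], so that [dist x set0 = +oo]. *)
Definition dist (R : realType) (X : metricType R) (x : X) (S : set X) : \bar R :=
  ereal_inf [set (mdist x s)%:E | s in S].

Definition sv_graph (X Y : Type) (F : X -> set Y) : set (X * Y) :=
  [set p | F p.1 p.2].

Definition sv_inv (X Y : Type) (F : X -> set Y) (y : Y) : set X :=
  [set x | F x y].

(* Here [0 * +oo = 0]. The convention only affects whether the single value
   k = 0 is admissible, hence neither metric subregularity nor the modulus. *)
Definition subreg_ineq (R : realType) (X Y : metricType R) (F : X -> set Y)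
    (xbar : X) (ybar : Y) (k r : R) : Prop :=
  forall x, cball xbar r x ->
    (dist x (sv_inv F ybar) <= k%:E * dist ybar (F x))%E.

Definition metrically_subregular (R : realType) (X Y : metricType R)
    (F : X -> set Y) (xbar : X) (ybar : Y) : Prop :=
  exists k r : R, [/\ 0 <= k, 0 < r & subreg_ineq F xbar ybar k r].

Definition subreg (R : realType) (X Y : metricType R) (F : X -> set Y)
    (xbar : X) (ybar : Y) : \bar R :=
  ereal_inf [set k%:E | k in
    [set k : R | 0 <= k /\ exists2 r : R, 0 < r & subreg_ineq F xbar ybar k r]].

Definition strongly_metrically_subregular (R : realType) (X Y : metricType R)
    (F : X -> set Y) (xbar : X) (ybar : Y) : Prop :=
  metrically_subregular F xbar ybar /\ isolated (sv_inv F ybar) xbar.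

(* [xbar^'] is the filter of punctured neighbourhoods of xbar. If xbar is
   isolated in X, it contains [set0] and the lower limit is +oo. *)
Definition steepest_displacement_rate (R : realType) (X Y : metricType R)
    (F : X -> set Y) (xbar : X) (ybar : Y) : \bar R :=
  limf_einf (fun x : X =>
    ((dist ybar (F x) - dist ybar (F xbar)) / (mdist x xbar)%:E)%E) xbar^'.

(* Main.v *)
Require Import Defs.
From HB Require Import structures.
From mathcomp Require Import all_boot all_order all_algebra.
From mathcomp Require Import all_classical all_reals all_analysis.
From mathcomp Require Import lra.

Import Order.TTheory GRing.Theory Num.Theory.
Import numFieldNormedType.Exports.

(** Both sides of the equivalence, and both sides of the formula for the
    modulus, are governed by one family of local estimates, indexed by the
    real numbers [k > 0]:

      [d(x, xbar) <= k * dist(ybar, F x)] for all [x] near [xbar].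

    On the one hand, dividing by [d(x, xbar)] turns this estimate into the
    lower bound [1/k] for the difference quotient.  Hence the estimate implies
    [1/k <= rate] ([near_calm_rate_ge]) and is implied by [1/k < rate]
    ([rate_gt_near_calm]).

    On the other hand, [d(x, xbar)] always bounds [dist(x, F^-1(ybar))] from
    above, so the estimate implies the subregularity inequality with constant
    [k] ([near_calm_subreg]).  When [xbar] is isolated in [F^-1(ybar)], the two
    distances coincide near [xbar] ([isolated_near_dist]), so conversely each
    constant [k] of subregularity yields the estimate for all larger constants
    ([subreg_near_calm]).  Finally the estimate itself forces [xbar] to be
    isolated, because [dist(ybar, F x) = 0] when [x] is in [F^-1(ybar)]
    ([near_calm_isolated]).

    Comparing the thresholds in [k], up to an arbitrarily small margin, gives
    that the infimum of the constants of subregularity is [1/rate]. *)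

Local Open Scope classical_set_scope.
Local Open Scope ring_scope.

Section lower_limit.
Context {R : realType} {T : choiceType} {X : filteredType T}.
Implicit Types (f : X -> \bar R) (F : set_system X) (a : \bar R).

Lemma near_le_limf_einf {f F a} :
  (\forall x \near F, (a <= f x)%E) -> (a <= limf_einf f F)%E.
Proof.
move=> Fa; rewrite limf_einfE.
apply: le_trans _ (ereal_sup_ubound _); last by exists [set x | (a <= f x)%E].
by apply: le_ereal_inf_tmp => _ [x ax <-].
Qed.

Lemma lt_limf_einf_near {f F a} {FF : Filter F} :
  (a < limf_einf f F)%E -> \forall x \near F, (a <= f x)%E.
Proof.
rewrite limf_einfE => /ereal_sup_gt[_ [V FV <-]] aV.
apply: filterS FV => x Vx.
by apply: le_trans (ltW aV) _; apply: ereal_inf_lbound; exists x.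
Qed.

End lower_limit.

Section metric.
Context {R : realType} {X : metricType R}.
Implicit Types (x s : X) (S : set X).

Lemma dist_ge0 x S : (0 <= dist x S)%E.
Proof. by apply: le_ereal_inf_tmp => _ [s _ <-]; rewrite lee_fin mdist_ge0. Qed.

Lemma dist_le {x s S} : S s -> (dist x S <= (mdist x s)%:E)%E.
Proof. by move=> Ss; apply: ereal_inf_lbound; exists s. Qed.

Lemma dist_mem {x S} : S x -> dist x S = 0%E.
Proof.
move=> Sx; apply/eqP; rewrite eq_le dist_ge0 andbT.
by have := dist_le (x := x) Sx; rewrite mdistxx.
Qed.

Lemma near_cballP x (P : set X) :
  (\forall z \near x, P z) <-> exists2 r : R, 0 < r & cball x r `<=` P.
Proof.
split=> [/metricType_numDomainType.nbhs_mdistP[r /= r0 rP]|[r r0 rP]].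
  exists (r / 2); first by rewrite divr_gt0.
  move=> z /= xz; apply: rP => /=; apply: le_lt_trans xz _.
  by rewrite ltr_pdivrMr// ltr_pMr// ltr1n.
by apply/metricType_numDomainType.nbhs_mdistP; exists r => //= z /= /ltW; exact: rP.
Qed.

(** Within half the radius of a ball that isolates [x] in [S], every other
    point of [S] is at least as far as [x] by the triangle inequality. *)
Lemma isolated_near_dist {S x} : isolated S x ->
  \forall z \near x, dist z S = (mdist z x)%:E.
Proof.
move=> [/set_mem Sx [V /metricType_numDomainType.nbhs_mdistP[r /= r0 rV] VS]].
apply/metricType_numDomainType.nbhs_mdistP; exists (r / 2) => /=; first by rewrite divr_gt0.
move=> z /= xz; apply/eqP; rewrite eq_le dist_le//=.
apply: le_ereal_inf_tmp => _ [s Ss <-]; rewrite lee_fin.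
have [xs|rxs] := ltP (mdist x s) r.
  suff -> : s = x by [].
  by have : (V `&` S) s; [split => //; exact: rV|rewrite VS].
have := le_trans rxs (metric_triangle x z s); rewrite (metric_sym z x).
by move: xz; lra.
Qed.

End metric.

Section subregularity.
Context {R : realType} {X Y : metricType R} {F : X -> set Y}.
Context {xbar : X} {ybar : Y} (xyF : F xbar ybar).

Local Notation calm k :=
  (\forall x \near xbar, ((mdist x xbar)%:E <= k%:E * dist ybar (F x))%E).
Local Notation rate := (steepest_displacement_rate F xbar ybar).

(** The subtracted term of the difference quotient vanishes at a point of the
    graph, and the denominator is a positive real number off [xbar]. *)
Lemma inv_le_quotientE {k : R} {x : X} : 0 < k -> x != xbar ->
  (k^-1%:E <=
     (dist ybar (F x) - dist ybar (F xbar)) / (mdist x xbar)%:E)%E =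
  ((mdist x xbar)%:E <= k%:E * dist ybar (F x))%E.
Proof.
move=> k0 xxbar; have d0 : 0 < mdist x xbar by rewrite mdist_gt0.
rewrite (dist_mem xyF) sube0 inver gt_eqF//.
by rewrite lee_pdivlMr// lee_pdivrMl.
Qed.

Lemma near_calm_rate_ge {k : R} : 0 < k -> calm k -> (k^-1%:E <= rate)%E.
Proof.
move=> k0 ck; apply: near_le_limf_einf; rewrite near_withinE.
by apply: filterS ck => x cx xxbar; rewrite inv_le_quotientE.
Qed.

Lemma rate_gt_near_calm {k : R} : 0 < k -> (k^-1%:E < rate)%E -> calm k.
Proof.
move=> k0 /lt_limf_einf_near; rewrite near_withinE; apply: filterS => x cx.
have [->|xxbar] := eqVneq x xbar; last by rewrite -inv_le_quotientE// cx.
by rewrite mdistxx mule_ge0 ?dist_ge0// lee_fin ltW.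
Qed.

Lemma near_calm_subreg {k : R} : calm k ->
  exists2 r : R, 0 < r & subreg_ineq F xbar ybar k r.
Proof.
move=> /near_cballP[r r0 rk]; exists r => // x /rk; apply: le_trans.
exact: dist_le.
Qed.

(** The larger constant [k'] serves to reach a positive one from [k = 0], which
    may be admissible for the modulus but has no inverse to compare with the
    rate. *)
Lemma subreg_near_calm {k k' r : R} : isolated (sv_inv F ybar) xbar ->
  0 < r -> subreg_ineq F xbar ybar k r -> k <= k' -> calm k'.
Proof.
move=> iso r0 rk kk'.
have near_r : \forall x \near xbar, cball xbar r x by apply/near_cballP; exists r.
apply: filterS2 near_r (isolated_near_dist iso) => x /rk /[swap] -> xk.
by apply: le_trans xk _; rewrite lee_wpmul2r ?dist_ge0// lee_fin.
Qed.

Lemma near_calm_isolated {k : R} : calm k -> isolated (sv_inv F ybar) xbar.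
Proof.
move=> ck; split; first exact/mem_set.
exists [set x | ((mdist x xbar)%:E <= k%:E * dist ybar (F x))%E] => //.
apply/seteqP; split=> [x [/= + Fx]|_ ->]; last first.
  by split => //=; rewrite mdistxx (dist_mem xyF) mule0.
rewrite (dist_mem (Fx : F x ybar)) mule0 lee_fin => d0.
by apply: mdist_positivity; apply/eqP; rewrite eq_le d0 mdist_ge0.
Qed.

End subregularity.

(* On [\bar R], [+oo^-1 = 0]. *)
Theorem proposition1 (R : realType) (X Y : metricType R) (F : X -> set Y)
    (xbar : X) (ybar : Y) (hgraph : sv_graph F (xbar, ybar)) :
  (strongly_metrically_subregular F xbar ybar <->
     (0 < steepest_displacement_rate F xbar ybar)%E) /\
  ((0 < steepest_displacement_rate F xbar ybar)%E ->
     subreg F xbar ybar = ((steepest_displacement_rate F xbar ybar)^-1)%E).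
Proof.
have xyF : F xbar ybar := hgraph.
set rate := steepest_displacement_rate F xbar ybar.
have rate_calm (k : R) : (0 < rate)%E -> 0 < k -> (rate^-1 < k%:E)%E ->
    \forall x \near xbar, ((mdist x xbar)%:E <= k%:E * dist ybar (F x))%E.
  move=> rate0 k0; rewrite inve_plt ?inE ?(ltW rate0) ?lee_fin ?(ltW k0)//.
  by rewrite inver gt_eqF//; exact: rate_gt_near_calm.
(* A positive rate, possibly infinite, has a real inverse [p], so that the
   constants above the threshold are the [p + e] with [0 < e]. *)
have invrate (rate0 : (0 < rate)%E) :
    exists2 p : R, 0 <= p & (rate^-1)%E = p%:E.
  have : (0 <= rate^-1)%E by rewrite inve_ge0 ltW.
  have : (rate^-1 != +oo)%E by rewrite inve_eqy gt_eqF.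
  by case: (rate^-1)%E => [p _|//|//]; rewrite lee_fin; exists p.
split; first split.
- move=> [[k [r [k0 r0 rk]] iso]].
  have k1 : 0 < k + 1 by rewrite ltr_wpDl.
  apply: lt_le_trans (near_calm_rate_ge xyF k1 _).
    by rewrite lte_fin invr_gt0.
  by apply: subreg_near_calm iso r0 rk _; rewrite lerDl.
- move=> rate0; have [p p0 pE] := invrate rate0.
  have p1 : 0 < p + 1 by rewrite ltr_wpDl.
  have calm_p1 := rate_calm _ rate0 p1.
  rewrite pE lte_fin ltrDl ltr01 in calm_p1; have {}calm_p1 := calm_p1 isT.
  split; last exact: near_calm_isolated calm_p1.
  have [r r0 rp] := near_calm_subreg xyF calm_p1.
  by exists (p + 1), r; split => //; exact: ltW.
- move=> rate0; have [p p0 pE] := invrate rate0.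
  have pe_gt0 e : 0 < e -> 0 < p + e by move=> e0; rewrite ltr_wpDl.
  have calm_pe e : 0 < e -> \forall x \near xbar,
      ((mdist x xbar)%:E <= (p + e)%:E * dist ybar (F x))%E.
    by move=> e0; apply: rate_calm; rewrite ?pE ?lte_fin ?ltrDl ?pe_gt0.
  apply/eqP; rewrite eq_le; apply/andP; split.
    rewrite pE; apply/lee_addgt0Pr => e e0; rewrite -EFinD.
    apply: ereal_inf_lbound; exists (p + e) => //; split; first exact/ltW/pe_gt0.
    exact: near_calm_subreg (calm_pe e e0).
  apply: le_ereal_inf_tmp => _ [k [k0 [r r0 rk]] <-].
  apply/lee_addgt0Pr => e e0; rewrite -EFinD.
  (* The margin [e] covers [k = 0], which has no real inverse. *)
  have ke : 0 < k + e by rewrite ltr_wpDl.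
  rewrite inve_ple ?inE ?(ltW rate0) ?lee_fin ?(ltW ke)// inver gt_eqF//.
  apply: near_calm_rate_ge => //.
  have iso := near_calm_isolated xyF (calm_pe 1 ltr01).
  by apply: subreg_near_calm iso r0 rk _; rewrite lerDl ltW.
Qed.
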